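(* Let $n,k$ be integers with $k\ge1$, $n>2k$. For every minimum vertex cover $c^*$ of the generalized Petersen graph $P(n,k)$ we have $a(c^* )-b(c^* )=d(P(n,k))$.
   Context: $P(n,k)$ has vertex set $U\cup V$, $U=\{u_1,\dots,u_n\}$, $V=\{v_1,\dots,v_n\}$, edges $u_iu_{i+1}$, $u_iv_i$, $v_iv_{i+k}$ (subscripts modulo $n$). A cover is non-trivial if it does not contain all of $V$; $\mathcal{C}(P(n,k))$ is the set of non-trivial vertex covers. For a non-trivial cover $c$, a strip is a maximal set of circularly consecutive vertices $\{v_i,v_{i+1},\dots,v_{i+m}\}$ of $V$ all in $c$; a strip is odd if it has an odd number of vertices. $a(c)=|c\cap V|$, $b(c)$ is the number of odd strips of $c$, and $d(P(n,k))=\min_{c\in\mathcal{C}(P(n,k))}(a(c)-b(c))$. (Minimum vertex covers are non-trivial.) *)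

(* Defs.v *)
From mathcomp Require Import all_boot all_order all_algebra.
Set Implicit Arguments.
Unset Strict Implicit.
Unset Printing Implicit Defensive.
Import Order.TTheory GRing.Theory Num.Theory.

Definition vertex_cover (T : finType) (e : rel T) (c : {set T}) : bool :=
  [forall x, forall y, e x y ==> (x \in c) || (y \in c)].

Definition minimum_vertex_cover (T : finType) (e : rel T) (c : {set T}) : Prop :=
  vertex_cover e c /\ forall c' : {set T}, vertex_cover e c' -> #|c| <= #|c'|.

(* [inl i] is u_i and [inr i] is v_i; indices are 0, ..., n-1. *)
Notation gp_vertex n := ('I_n + 'I_n)%type.

Definition gp_arrow (n k : nat) : rel (gp_vertex n) := fun x y =>
  match x, y with
  | inl i, inl j => val j == (i + 1) %% n
  | inl i, inr j => i == j
  | inr i, inr j => val j == (i + k) %% n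
  | inr _, inl _ => false
  end.

Definition gpetersen (n k : nat) : rel (gp_vertex n) :=
  fun x y => gp_arrow k x y || gp_arrow k y x.
Arguments gpetersen : clear implicits.

Definition gp_inner (n : nat) : {set gp_vertex n} := [set inr i | i : 'I_n].

Definition nontrivial_covers (n k : nat) : {set {set gp_vertex n}} :=
  [set c | vertex_cover (gpetersen n k) c && ~~ (gp_inner n \subset c)].
Arguments nontrivial_covers : clear implicits.

(* {v_i, v_(i+1), ..., v_(i+m)}, subscripts modulo n *)
Definition gp_arc (n : nat) (i m : 'I_n) : {set gp_vertex n} :=
  [set inr j | j : 'I_n & [exists t : 'I_n, (t <= m) && (val j == (i + t) %% n)]].

Definition consecutive (n : nat) (S : {set gp_vertex n}) : bool :=
  [exists i : 'I_n, exists m : 'I_n, S == gp_arc i m].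

Definition strip (n : nat) (c S : {set gp_vertex n}) : bool :=
  maxset (fun A : {set gp_vertex n} => consecutive A && (A \subset c)) S.

Definition gp_a (n : nat) (c : {set gp_vertex n}) : nat := #|c :&: gp_inner n|.

Definition gp_b (n : nat) (c : {set gp_vertex n}) : nat :=
  #|[set S : {set gp_vertex n} | strip c S && odd #|S|]|.

Local Open Scope ring_scope.

Definition gp_ab (n : nat) (c : {set gp_vertex n}) : int :=
  (gp_a c)%:Z - (gp_b c)%:Z.

(* The initial value n is harmless, since a(c) - b(c) <= n for every c;
   [gp_dP] shows that this is the minimum over the non-trivial covers. *)
Definition gp_d (n k : nat) : int :=
  \big[Num.min/n%:Z]_(c in nontrivial_covers n k) gp_ab c.

Lemma gp_ab_le (n : nat) (c : {set gp_vertex n}) : gp_ab c <= n%:Z.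
Proof.
rewrite /gp_ab lerBlDr -PoszD lez_nat (leq_trans _ (leq_addr _ _)) //.
apply: leq_trans (subset_leq_card (subsetIr _ _)) _.
by rewrite (leq_trans (leq_imset_card _ _)) // card_ord.
Qed.

Lemma nontrivial_covers_neq0 (n k : nat) :
  (1 <= k)%N -> (2 * k < n)%N -> exists c, c \in nontrivial_covers n k.
Proof.
move=> k0 kn; have n0 : (0 < n)%N by apply: leq_trans kn.
have kltn : (k < n)%N by rewrite (leq_ltn_trans _ kn) // leq_pmull.
pose o := Ordinal n0; exists [set~ inr o]; rewrite inE; apply/andP; split.
  apply/forallP=> x; apply/forallP=> y; apply/implyP; rewrite !inE -negb_and.
  apply: contraL => /andP[/eqP-> /eqP->].
  by rewrite /gpetersen /= orbb add0n modn_small //; case: k k0 {kn kltn}.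
apply/subsetPn; exists (inr o); first by apply/imsetP; exists o.
by rewrite !inE eqxx.
Qed.

Lemma gp_dP (n k : nat) : (1 <= k)%N -> (2 * k < n)%N ->
  (exists2 c, c \in nontrivial_covers n k & gp_ab c = gp_d n k) /\
  (forall c, c \in nontrivial_covers n k -> gp_d n k <= gp_ab c).
Proof.
move=> k0 kn; have [c0 c0P] := nontrivial_covers_neq0 k0 kn.
split; last by move=> c cP; apply: bigmin_le_cond.
have [c cP E] := eq_bigmin c0 (mem (nontrivial_covers n k)) (@gp_ab n)
  c0P (fun c _ => gp_ab_le c).
by exists c; rewrite // -E.
Qed.

(* Main.v *)
(** Let [W] be the set of indices of the vertices of [V] missing from a
non-trivial cover [c], and let [gap W i] be the distance from [i] back to [W],
i.e. the position of [v_i] in its strip.  The vertices [u_i] with [gap W i]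
even complete the [V]-part of [c] to a cover, and no completion is smaller: if
[u_i] is missing and [gap W i] is even, then [i] is not in [W], so [u_(i-1)] is
present and [gap W (i-1)] is odd.  Counting the odd strips by their last
indices shows that this completion has exactly [n + (a(c) - b(c)) / 2]
vertices, so minimizing the size amounts to minimizing [a - b]. *)
Require Import Defs.
From mathcomp Require Import all_boot all_order all_algebra.
From mathcomp Require Import zify.

Set Implicit Arguments.
Unset Strict Implicit.
Unset Printing Implicit Defensive.

(** * Backward distances to a subset of the cyclic index set, and their parities *)

Section CyclicGap.
Variable n : nat.
Implicit Types (i j e : 'I_n) (t : nat).

Lemma val_iter_ordS t i : val (iter t (@ordS n) i) = (i + t) %% n.
Proof.
elim: t => [|t IHt] /=; first by rewrite addn0 modn_small.
by rewrite IHt -addn1 modnDml addn1 addnS.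
Qed.

Lemma iter_ord_predK t : cancel (iter t (@ord_pred n)) (iter t (@ordS n)).
Proof. by elim: t => // t IHt i; rewrite iterSr /= ord_predK IHt. Qed.

Lemma iter_ordSK t : cancel (iter t (@ordS n)) (iter t (@ord_pred n)).
Proof. by elim: t => // t IHt i; rewrite iterSr /= ordSK IHt. Qed.

Lemma iter_ordS_trans i j : exists2 t, t < n & iter t (@ordS n) i = j.
Proof.
have [ilt jlt] := (ltn_ord i, ltn_ord j).
(* The difference [j - i] modulo [n], written so that the natural subtraction does not truncate. *)
exists ((j + (n - i)) %% n); first by rewrite ltn_mod; lia.
apply: val_inj; rewrite val_iter_ordS modnDmr.
have -> : i + (j + (n - i)) = j + n by lia.
by rewrite modnDr modn_small.
Qed.

Lemma iter_ord_pred_trans i j : exists2 t, t < n & iter t (@ord_pred n) i = j.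
Proof.
by have [t tn <-] := iter_ordS_trans j i; exists t; rewrite ?iter_ordSK.
Qed.

Lemma iter_ordS_inj i t1 t2 : t1 < n -> t2 < n ->
  iter t1 (@ordS n) i = iter t2 (@ordS n) i -> t1 = t2.
Proof.
move=> t1n t2n /(congr1 val); rewrite !val_iter_ordS => /eqP.
by rewrite eqn_modDl !modn_small // => /eqP.
Qed.

Lemma iter_ord_pred_inj i t1 t2 : t1 < n -> t2 < n ->
  iter t1 (@ord_pred n) i = iter t2 (@ord_pred n) i -> t1 = t2.
Proof.
wlog le12 : t1 t2 / t1 <= t2 => [IH|] t1n t2n E.
  have [/IH|/ltnW /IH] := leqP t1 t2; first exact.
  by move=> H; apply/esym/H.
apply/esym/(@iter_ordS_inj (iter t2 (@ord_pred n) i)) => //.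
by rewrite iter_ord_predK -E iter_ord_predK.
Qed.

Definition gap (W : {set 'I_n}) i := find (mem W) (traject (@ord_pred n) i n).

Variable W : {set 'I_n}.
Hypothesis W_neq0 : W != set0.

(** The backward orbit of length [n] visits every index, so it meets the non-empty [W] and [find]
    never returns its default value [n]. *)
Lemma has_gap i : has (mem W) (traject (@ord_pred n) i n).
Proof.
have /set0Pn [w wW] := W_neq0; have [t tn Et] := iter_ord_pred_trans i w.
by apply/hasP; exists w => //; apply/trajectP; exists t.
Qed.

Lemma ltn_gap i : gap W i < n.
Proof. by have := has_gap i; rewrite has_find size_traject. Qed.

Lemma mem_gap i : iter (gap W i) (@ord_pred n) i \in W.
Proof. by have := nth_find i (has_gap i); rewrite nth_traject ?ltn_gap. Qed.

Lemma before_gap i t : t < gap W i -> iter t (@ord_pred n) i \notin W.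
Proof.
move=> tg; have := before_find i tg.
by rewrite nth_traject ?(ltn_trans tg (ltn_gap i)) // => /negbT.
Qed.

Lemma gap_geq i t :
  (forall t', t' < t -> iter t' (@ord_pred n) i \notin W) -> t <= gap W i.
Proof. by move=> Ht; case: leqP => // /Ht; rewrite mem_gap. Qed.

Lemma gap_leq i t : iter t (@ord_pred n) i \in W -> gap W i <= t.
Proof. by move=> Ht; case: leqP => // /before_gap; rewrite Ht. Qed.

Lemma gap_eq0 i : (gap W i == 0) = (i \in W).
Proof.
apply/eqP/idP => [g0|iW]; first by have := mem_gap i; rewrite g0.
by have := @gap_leq i 0 iW; case: gap.
Qed.

(** Hence parity alternates between two visits to [W]; the counting, the lower bound and the cover
    property below all rest on this recurrence. *)
Lemma gap_ordS i : gap W (ordS i) = if ordS i \in W then 0 else (gap W i).+1.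
Proof.
case: ifPn => [|SiNW]; first by rewrite -gap_eq0 => /eqP.
apply/eqP; rewrite eqn_leq gap_leq /=; last by rewrite -iterS iterSr ordSK mem_gap.
by apply: gap_geq => -[|t] //; rewrite ltnS iterSr ordSK; apply: before_gap.
Qed.

Definition even_gap := [set i | ~~ odd (gap W i)].
(** For [W] the missing inner indices, these are the last indices of the odd strips (see
    [gp_bE]). *)
Definition odd_ends := [set i | odd (gap W i) & ordS i \in W].

Lemma card_even_gap : 2 * #|even_gap| + #|odd_ends| = n + #|W|.
Proof.
have WE : W \subset even_gap.
  by apply/subsetP => i; rewrite -gap_eq0 inE => /eqP->.
have ZO : odd_ends \subset ~: even_gap.
  by apply/subsetP => i; rewrite !inE negbK => /andP[].
(* Outside [W] an even gap follows an odd one. The successor thus matches the odd gaps that are not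
   odd ends with the even gaps outside [W], and comparing cardinals gives the identity. *)
have preim : @ordS n @^-1: (even_gap :\: W) = ~: even_gap :\: odd_ends.
  apply/setP => i; rewrite !inE gap_ordS negbK.
  by case: (ordS i \in W); rewrite /= ?andbT ?andbF ?negbK ?andNb.
have := card_preimset (even_gap :\: W) (@ordS_inj n).
rewrite preim !cardsD (setIidPr WE) (setIidPr ZO).
have := cardsC even_gap; rewrite card_ord.
have := subset_leq_card WE; have := subset_leq_card ZO.
by move: #|odd_ends| #|even_gap| #|~: even_gap| #|W| => *; lia.
Qed.

(** The map [h] injects [even_gap] into [X]: an index missing from [X] moves to its predecessor,
    which lies in [X] and has odd gap, so it is not the image of another even index. *)
Lemma leq_card_even_gap (X : {set 'I_n}) : W \subset X ->
  (forall i, (i \in X) || (ordS i \in X)) -> #|even_gap| <= #|X|.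
Proof.
move=> WX edgeX; pose h i := if i \in X then i else ord_pred i.
have odd_pred i : i \notin X -> i \in even_gap -> odd (gap W (ord_pred i)).
  move=> iNX; rewrite inE -{1}(ord_predK i) gap_ordS ord_predK.
  by rewrite (contraNF (subsetP WX i)) //= negbK.
have h_inj : {in even_gap &, injective h}.
  move=> i j iE jE; rewrite /h; case: ifPn => iX; case: ifPn => jX // hij.
  - by have := odd_pred j jX jE; rewrite -hij; move: iE; rewrite inE => /negPf->.
  - by have := odd_pred i iX iE; rewrite hij; move: jE; rewrite inE => /negPf->.
  - exact: ord_pred_inj hij.
rewrite -(card_in_imset h_inj); apply/subset_leq_card/subsetP => _ /imsetP[i _ ->].
rewrite /h; case: ifPn => // iNX.
by have := edgeX (ord_pred i); rewrite ord_predK (negPf iNX) orbF.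
Qed.

End CyclicGap.

(** * Strips described by their last indices *)

Section Strips.
Variables (n : nat) (c : {set gp_vertex n}).

Definition outer_part : {set 'I_n} := [set i | inl i \in c].
Definition inner_gaps : {set 'I_n} := [set i | inr i \notin c].

(** The run of present inner vertices read backwards from [e]; it is a whole strip only if [ordS e]
    is missing. *)
Definition strip_ending (e : 'I_n) : {set gp_vertex n} :=
  [set inr (iter (val t) (@ord_pred n) e) | t : 'I_n & t < gap inner_gaps e].

Lemma gp_arcP (i m : 'I_n) (x : gp_vertex n) :
  reflect (exists2 t, t <= m & x = inr (iter t (@ordS n) i)) (x \in gp_arc i m).
Proof.
apply: (iffP imsetP) => [[j] | [t tm ->]].
  rewrite inE => /existsP[t /andP[tm /eqP Ej]] ->; exists t => //.
  by congr inr; apply: val_inj; rewrite val_iter_ordS.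
exists (iter t (@ordS n) i) => //; rewrite inE; apply/existsP.
by exists (Ordinal (leq_ltn_trans tm (ltn_ord m))); rewrite tm val_iter_ordS /=.
Qed.

Lemma gp_aE : gp_a c + #|inner_gaps| = n.
Proof.
have -> : gp_a c = #|~: inner_gaps|.
  rewrite -(card_imset _ (@inr_inj 'I_n 'I_n)); congr #|pred_of_set _|.
  apply/setP => x; rewrite inE; apply/andP/imsetP.
    by case=> xc /imsetP[i _ Ex]; exists i; rewrite // !inE negbK -Ex.
  by case=> i; rewrite !inE negbK => ic ->; split=> //; apply/imsetP; exists i.
by rewrite addnC cardsC card_ord.
Qed.

Lemma card_outer_inner : #|c| = #|outer_part| + gp_a c.
Proof.
have -> : gp_a c = #|~: inner_gaps|.
  by apply: (@addnI #|inner_gaps|); rewrite cardsC card_ord addnC gp_aE.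
rewrite -!sum1_card big_sumType /=; congr (_ + _).
  by apply: eq_bigl => i; rewrite inE.
by apply: eq_bigl => i; rewrite !inE negbK.
Qed.

Lemma inner_gaps_neq0 : (inner_gaps != set0) = ~~ (gp_inner n \subset c).
Proof.
apply/set0Pn/subsetPn => [[i] | [_ /imsetP[i _ ->] iNc]].
  by rewrite inE => iNc; exists (inr i) => //; apply/imsetP; exists i.
by exists i; rewrite inE.
Qed.

Hypothesis c_nontriv : ~~ (gp_inner n \subset c).

Let W_neq0 : inner_gaps != set0.
Proof. by rewrite inner_gaps_neq0. Qed.

Lemma strip_endingP (e : 'I_n) (x : gp_vertex n) :
  reflect (exists2 t, t < gap inner_gaps e & x = inr (iter t (@ord_pred n) e))
          (x \in strip_ending e).
Proof.
apply: (iffP imsetP) => [[t] | [t tg ->]]; first by rewrite inE; exists t.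
by exists (Ordinal (ltn_trans tg (ltn_gap W_neq0 e))); rewrite ?inE.
Qed.

Lemma card_strip_ending e : #|strip_ending e| = gap inner_gaps e.
Proof.
rewrite card_in_imset; last first.
  by move=> s t _ _ [] /iter_ord_pred_inj E; apply/val_inj/E.
have gn := ltnW (ltn_gap W_neq0 e).
rewrite -sum1_card (eq_bigl (fun t : 'I_n => t < gap inner_gaps e)).
  by rewrite (big_ord_narrow gn) sum1_card card_ord.
by move=> t; rewrite inE.
Qed.

Lemma strip_ending_sub e : strip_ending e \subset c.
Proof.
apply/subsetP => x /strip_endingP[t /(before_gap W_neq0)].
by rewrite inE negbK => ? ->.
Qed.

Lemma strip_ending_consecutive e : e \notin inner_gaps ->
  consecutive (strip_ending e).
Proof.
rewrite -(gap_eq0 W_neq0) -lt0n => g0.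
have gn := ltn_gap W_neq0 e; set g := gap _ _ in g0 gn *.
have gn1 : g.-1 < n by lia.
(* An arc with parameter [m] has [m + 1] vertices, so a run of [g] vertices starts [g - 1] steps
   before [e] and has parameter [g - 1]. *)
apply/existsP; exists (iter g.-1 (@ord_pred n) e); apply/existsP.
exists (Ordinal gn1); apply/eqP/setP => x.
have shift t : t <= g.-1 ->
    iter t (@ordS n) (iter g.-1 (@ord_pred n) e) = iter (g.-1 - t) (@ord_pred n) e.
  by move=> tg; rewrite -{1}(subnKC tg) iterD iter_ord_predK.
apply/strip_endingP/gp_arcP => /= -[t tg ->]; exists (g.-1 - t); rewrite -/g.
- lia.
- by rewrite shift ?leq_subr // subKn //; lia.
- lia.
- by rewrite shift.
Qed.

(** Walking forward from the start of the arc, stop just before the first missing index: this is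
    [e], and the run backwards from it covers the arc. *)
Lemma consecutive_sub_strip_ending S : consecutive S -> S \subset c ->
  exists e, [/\ e \notin inner_gaps, ordS e \in inner_gaps & S \subset strip_ending e].
Proof.
move=> /existsP[i /existsP[m /eqP->]] /subsetP arc_c.
have exW : exists t, iter t (@ordS n) i \in inner_gaps.
  have /set0Pn[w wW] := W_neq0; have [t _ Et] := iter_ordS_trans i w.
  by exists t; rewrite Et.
case: (ex_minnP exW) => q qW qmin.
have arcNW t : t <= m -> iter t (@ordS n) i \notin inner_gaps.
  by move=> tm; rewrite inE negbK; apply: arc_c; apply/gp_arcP; exists t.
have mq : m < q by case: ltnP => // /arcNW; rewrite qW.
(* From here on [q] is the offset of the last present index, one less than that of the first missing
   one. *)
case: q => // q in qW qmin mq *.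
have beforeNW t : t <= q -> iter t (@ordS n) i \notin inner_gaps.
  by move=> tq; apply: contraL tq => /qmin; rewrite -ltnNge.
have shift t : t <= q ->
    iter t (@ord_pred n) (iter q (@ordS n) i) = iter (q - t) (@ordS n) i.
  by move=> tq; rewrite -{1}(subnKC tq) iterD iter_ordSK.
exists (iter q (@ordS n) i); split=> //; first exact: beforeNW.
apply/subsetP => x /gp_arcP[t tm ->]; apply/strip_endingP.
exists (q - t); last by rewrite shift ?leq_subr // subKn //; lia.
apply: (@leq_trans q.+1); first by lia.
apply: gap_geq => // t' t'q; rewrite shift; last by lia.
by apply: beforeNW; rewrite leq_subr.
Qed.

(** If [e] lay strictly before [e'] in the run ending at [e'], its successor would belong to that
    run and could not be missing. *)
Lemma strip_ending_sub_inj e e' : e \notin inner_gaps -> ordS e \in inner_gaps ->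
  strip_ending e \subset strip_ending e' -> e = e'.
Proof.
rewrite -(gap_eq0 W_neq0 e) -lt0n => g0 SeW /subsetP /(_ (inr e)).
case/(_ _)/strip_endingP; first by apply/strip_endingP; exists 0.
case=> [_ [] //|t] tg [Ee]; move: SeW; rewrite Ee /= ord_predK.
by rewrite (negPf (before_gap W_neq0 (ltnW tg))).
Qed.

(** Every consecutive subset of [c] extends to a run with a genuine end, and such runs are pairwise
    incomparable, so they are exactly the maximal ones. *)
Lemma stripP S :
  reflect (exists e, [/\ e \notin inner_gaps, ordS e \in inner_gaps
                       & S = strip_ending e]) (strip c S).
Proof.
apply: (iffP maxsetP) => [[/andP[Scons Sc] Smax] | [e [eNW SeW ->]]].
  have [e [eNW SeW Sub]] := consecutive_sub_strip_ending Scons Sc.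
  exists e; split=> //; apply/esym/Smax => //.
  by rewrite strip_ending_consecutive // strip_ending_sub.
split; first by rewrite strip_ending_consecutive // strip_ending_sub.
move=> B /andP[Bcons Bc] Sub; have [e' [_ _ Be']] := consecutive_sub_strip_ending Bcons Bc.
apply/eqP; rewrite eqEsubset Sub andbT.
by rewrite (strip_ending_sub_inj eNW SeW (subset_trans Sub Be')).
Qed.

Lemma gp_bE : gp_b c = #|odd_ends inner_gaps|.
Proof.
have endNW e : e \in odd_ends inner_gaps -> e \notin inner_gaps.
  by rewrite inE -(gap_eq0 W_neq0 e) => /andP[]; case: gap.
have endS e : e \in odd_ends inner_gaps -> ordS e \in inner_gaps.
  by rewrite inE => /andP[].
rewrite /gp_b -(card_in_imset (f := strip_ending) (D := odd_ends inner_gaps)).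
  congr #|pred_of_set _|; apply/setP => S; rewrite inE; apply/andP/imsetP.
    case=> /stripP[e [eNW SeW ->]]; rewrite card_strip_ending => oddg.
    by exists e; rewrite // inE oddg.
  case=> e eO ->; split; first by apply/stripP; exists e; split; auto.
  by rewrite card_strip_ending; move: eO; rewrite inE => /andP[].
move=> e e' eO e'O E; apply: strip_ending_sub_inj; rewrite ?endNW ?endS //.
by rewrite E.
Qed.

Lemma card_even_gap_ab : 2 * #|even_gap inner_gaps| + gp_a c + gp_b c = 2 * n.
Proof. rewrite gp_bE; have := card_even_gap W_neq0; have := gp_aE; lia. Qed.

End Strips.

(** * Sizes of vertex covers in terms of [gp_a] and [gp_b] *)

Section Covers.
Variables (n k : nat).
Implicit Type c : {set gp_vertex n}.

(** One clause per kind of edge. The last involves the [V]-part alone, so it survives any change of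
    the [U]-part. *)
Lemma gp_coverP c :
  reflect [/\ forall i, (inl i \in c) || (inl (ordS i) \in c),
              inner_gaps c \subset outer_part c
            & forall i j : 'I_n, val j = (i + k) %% n -> (inr i \in c) || (inr j \in c)]
          (vertex_cover (gpetersen n k) c).
Proof.
apply: (iffP idP) => [cov | [covU covUV covV]].
  have edge x y : gpetersen n k x y -> (x \in c) || (y \in c).
    by move: cov => /forallP/(_ x)/forallP/(_ y)/implyP.
  split=> [i| |i j Ej].
  - by apply: edge; rewrite /gpetersen /= addn1 eqxx.
  - apply/subsetP => i; rewrite !inE => /negPf iNc.
    by have := edge (inl i) (inr i); rewrite iNc orbF /gpetersen /= eqxx; apply.
  - by apply: edge; rewrite /gpetersen /= Ej eqxx.
have arrow x y : gp_arrow k x y -> (x \in c) || (y \in c).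
  case: x y => i [] j //= /eqP.
  - rewrite addn1 => Ej; have -> : j = ordS i by apply: val_inj.
    exact: covU.
  - move=> <-; case: (boolP (inr i \in c)) => iNc; first by rewrite orbT.
    by have /subsetP/(_ i) := covUV; rewrite !inE iNc => ->.
  - exact: covV.
apply/forallP => x; apply/forallP => y; apply/implyP.
by case/orP => /arrow //; rewrite orbC.
Qed.

Definition recover c : {set gp_vertex n} :=
  [set x | match x with
           | inl i => i \in even_gap (inner_gaps c)
           | inr _ => x \in c
           end].

Lemma recover_cover c : c \in nontrivial_covers n k ->
  vertex_cover (gpetersen n k) (recover c).
Proof.
rewrite inE -inner_gaps_neq0 => /andP[/gp_coverP[_ _ covV] W0].
apply/gp_coverP; split=> [i| |i j /covV]; last by rewrite !inE.
  by rewrite !inE gap_ordS //; case: ifP => // => _ /=; case: odd.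
apply/subsetP => i; rewrite !inE => iNc.
by have := gap_eq0 W0 i; rewrite inE iNc => /eqP->.
Qed.

Lemma card_recover c : c \in nontrivial_covers n k ->
  2 * #|recover c| + gp_b c = 2 * n + gp_a c.
Proof.
rewrite inE => /andP[_ c_nontriv]; rewrite card_outer_inner.
have -> : outer_part (recover c) = even_gap (inner_gaps c).
  by apply/setP => i; rewrite !inE.
have -> : gp_a (recover c) = gp_a c.
  have gapsE : inner_gaps (recover c) = inner_gaps c.
    by apply/setP => i; rewrite !inE.
  have := gp_aE (recover c); rewrite gapsE => aE.
  by apply: (@addIn #|inner_gaps c|); rewrite aE gp_aE.
have := card_even_gap_ab c_nontriv; move: #|even_gap _| => *; lia.
Qed.

(** The [U]-part contains the missing inner indices and covers the outer cycle, so
    [leq_card_even_gap] applies; [card_recover] shows that the bound is attained. *)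
Lemma nontrivial_cover_card_geq c : c \in nontrivial_covers n k ->
  2 * n + gp_a c <= 2 * #|c| + gp_b c.
Proof.
rewrite inE card_outer_inner => /andP[/gp_coverP[covU covUV _] c_nontriv].
have W0 : inner_gaps c != set0 by rewrite inner_gaps_neq0.
have covX i : (i \in outer_part c) || (ordS i \in outer_part c) by rewrite !inE.
have := leq_card_even_gap W0 covUV covX; have := card_even_gap_ab c_nontriv.
move: #|even_gap _| #|outer_part c| => *; lia.
Qed.

(** To the [n] inner vertices is added at least half of the outer cycle, since the successor of a
    missing outer index is present. *)
Lemma trivial_cover_card_geq c : vertex_cover (gpetersen n k) c ->
  gp_inner n \subset c -> 3 * n <= 2 * #|c|.
Proof.
move=> /gp_coverP[covU _ _] triv.
have := inner_gaps_neq0 c; rewrite triv => /negbFE/eqP W0.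
have := gp_aE c; rewrite W0 cards0 card_outer_inner.
have : #|~: outer_part c| <= #|outer_part c|.
  rewrite -(card_imset _ (@ordS_inj n)); apply/subset_leq_card/subsetP.
  move=> _ /imsetP[i + ->]; rewrite !inE => iNc.
  by have := covU i; rewrite (negPf iNc).
have := cardsC (outer_part c); rewrite card_ord; lia.
Qed.

(** Completing any non-trivial cover [c0] gives twice the size at most [2n + a(c0) < 3n], which
    beats every trivial cover. *)
Lemma minimum_cover_nontrivial c : 1 <= k -> 2 * k < n ->
  minimum_vertex_cover (gpetersen n k) c -> c \in nontrivial_covers n k.
Proof.
move=> k0 kn [cov cmin]; rewrite inE cov /=; apply/negP => triv.
have [c0 c0P] := nontrivial_covers_neq0 k0 kn.
have := cmin _ (recover_cover c0P); have := trivial_cover_card_geq cov triv.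
have := card_recover c0P; have := gp_aE c0.
move: c0P; rewrite inE -inner_gaps_neq0 -card_gt0 => /andP[_].
move: #|inner_gaps c0| #|c| #|recover c0| => *; lia.
Qed.

End Covers.

Local Open Scope ring_scope.

Theorem theorem3 (n k : nat) (hk : (1 <= k)%N) (hn : (2 * k < n)%N)
    (c : {set gp_vertex n}) (hc : minimum_vertex_cover (gpetersen n k) c) :
  (gp_a c)%:Z - (gp_b c)%:Z = gp_d n k.
Proof.
have cP := minimum_cover_nontrivial hk hn hc.
have [[c0 c0P <-] /(_ c cP)] := gp_dP hk hn.
have [_ /(_ _ (recover_cover c0P))] := hc.
(* With [c0] attaining the minimum, [2n + a(c) - b(c) <= 2|c| <= 2|recover c0| = 2n + a(c0) -
   b(c0)]; the opposite inequality is the minimality of [c0]. *)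
have := card_recover c0P; have := nontrivial_cover_card_geq cP.
rewrite /gp_ab; move: #|c| #|recover c0| => *; lia.
Qed.
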